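(* Let $M_n(R)$ denote the ring of $n\times n$ matrices over a ring $R$. (i) $M_n(\mathbb{Z})$ is tightly F-noetherian. More generally, $M_n(R)$ is tightly F-noetherian if $R$ is a module-finite ring extension of $\mathbb{Z}$ or of a prime field $\mathbb{Z}_p$. (ii) $M_2(\mathbb{Z}[x])$ is noetherian but not tightly F-noetherian. (iii) If $R$ is an F-noetherian ring, then so is $M_n(R)$.
   Context: All rings have an identity $1$, and subrings contain $1$; ''noetherian'' means left and right noetherian. A ring $R$ is F-noetherian if every finite subset of $R$ is contained in a noetherian subring of $R$; it is tightly F-noetherian if every finite subset of $R$ generates (as a ring) a noetherian subring of $R$. A ring $R\supseteq R_0$ is a module-finite ring extension of $R_0$ if it is finitely generated as an $R_0$-module. $\mathbb{Z}_p=\mathbb{Z}/p\mathbb{Z}$ with $p$ prime. *)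

(* Defs.v *)
From HB Require Import structures.
From mathcomp Require Import all_boot all_order all_algebra.
From mathcomp Require Import classical_sets cardinality.

Set Implicit Arguments.
Unset Strict Implicit.
Unset Printing Implicit Defensive.

Import GRing.Theory.
Local Open Scope classical_set_scope.
Local Open Scope ring_scope.

(* Rings are unital and possibly noncommutative; the zero ring is allowed. *)

Definition subring (R : pzRingType) (S : set R) : Prop :=
  subring_closed [in S].

(* One-sided ideals of a subring S of R, as subsets of R: multipliers range
   over S, not over R. *)
Definition left_ideal (R : pzRingType) (S I : set R) : Prop :=
  [/\ I `<=` S, I 0,
      forall x y, I x -> I y -> I (x - y)
    & forall a x, S a -> I x -> I (a * x)].

Definition right_ideal (R : pzRingType) (S I : set R) : Prop :=
  [/\ I `<=` S, I 0,
      forall x y, I x -> I y -> I (x - y)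
    & forall a x, S a -> I x -> I (x * a)].

Definition ascending_chain_condition (T : Type) (P : set T -> Prop) : Prop :=
  forall I : nat -> set T,
    (forall n, P (I n)) -> (forall n, I n `<=` I n.+1) ->
    exists N, forall n, (N <= n)%N -> I n = I N.

Definition noetherian_subring (R : pzRingType) (S : set R) : Prop :=
  [/\ subring S,
      ascending_chain_condition (left_ideal S)
    & ascending_chain_condition (right_ideal S)].

Definition noetherian (R : pzRingType) : Prop :=
  noetherian_subring [set: R].

Definition generated_subring (R : pzRingType) (A : set R) : set R :=
  smallest (@subring R) A.

Definition F_noetherian (R : pzRingType) : Prop :=
  forall A : set R, finite_set A ->
    exists S : set R, noetherian_subring S /\ A `<=` S.

Definition tightly_F_noetherian (R : pzRingType) : Prop :=
  forall A : set R, finite_set A -> noetherian_subring (generated_subring A).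

(* The inclusion of R0 in R is an injective ring morphism f; R is then finitely
   generated as a left R0-module.  Over int and 'F_p left and right agree, the
   image of f being central. *)
Definition module_finite_extension (R0 R : pzRingType) : Prop :=
  exists f : {rmorphism R0 -> R}, injective f /\
    exists (k : nat) (g : 'I_k -> R),
      forall x : R, exists c : 'I_k -> R0, x = \sum_(i < k) f (c i) * g i.

(* Main.v *)
Require Import Defs.
From HB Require Import structures.
From mathcomp Require Import all_boot all_order all_algebra.
From mathcomp Require Import boolp classical_sets cardinality.

Set Implicit Arguments.
Unset Strict Implicit.
Unset Printing Implicit Defensive.

Import GRing.Theory.
Local Open Scope ring_scope.

(** The positive assertions rest on one remark: the chain condition on
submodules passes to finite powers and to quotients.  It is proved for abelian
groups with a set of operators fixing 0, because the same statement must serve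
left ideals, right ideals and plain subgroups.  Powers
are handled by [acc_extension]: a chain of stable subgroups is controlled by
its images under a homomorphism and by its intersections with the kernel.

If [S] is a noetherian subring of [R], the matrices over [S] form a finite
power of [S], and a one-sided ideal of this matrix ring is a one-sided
[S]-submodule, the operators being multiplications by scalar matrices.  So the
matrix ring is noetherian ([noetherian_matrices_over]).  Taking for [S] a
noetherian subring that contains all the entries of finitely many matrices
shows that the F-noetherian property passes to matrix rings.

If [R] is module-finite over the integers or over a prime field, then it is a
finitely generated abelian group, since every element of these base rings is an
integer multiple of [1].  Hence so is the group of matrices over [R], and it
satisfies the chain condition on all subgroups.  The one-sided ideals of any
subring are such subgroups, so every subring of the matrix ring is noetherian
([tightly_F_noetherian_matrix_fg]).

Integer polynomials form a noetherian ring by the Hilbert basis theorem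
([left_hilbert_basis]), and so do the 2 by 2 matrices over them.  On the other
hand, the subring generated by [E12] and [x E22], where the [Eij] are the matrix units,
contains every [x^k E12], while its elements are upper triangular with a
constant upper left entry.  Such matrices multiply [p E12] on the left by
constants, so bounding the degree of [p] gives a strictly increasing chain of
left ideals ([not_tightly_F_noetherian_matrix2_poly]). *)

(** * Chains of subsets *)

Lemma acc_sub (T : Type) (P Q : set T -> Prop) :
  (forall I, P I -> Q I) ->
  ascending_chain_condition Q -> ascending_chain_condition P.
Proof. by move=> PQ accQ I PI; apply: accQ => n; apply: PQ. Qed.

Lemma chain_le (T : Type) (I : nat -> set T) (m n : nat) :
  (forall k, (I k `<=` I k.+1)%classic) -> (m <= n)%N -> (I m `<=` I n)%classic.
Proof.
move=> incI /subnK <-; elim: (n - m)%N => [//|k IHk] x Imx.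
by rewrite addSn; apply/incI/IHk.
Qed.

Lemma chain_stable_from (T : Type) (I : nat -> set T) (N M n : nat) :
  (forall k, (N <= k)%N -> I k = I N) -> (N <= M <= n)%N -> I n = I M.
Proof.
by move=> stI /andP[NM Mn]; rewrite stI ?(leq_trans NM Mn)// -(stI M).
Qed.

(** * Groups with operators *)

(** With [D := S] and [act] the left or right multiplication, this unfolds to
[left_ideal S] or [right_ideal S], and for an empty [D] it only says that [I]
is a subgroup.  One argument then covers these three cases. *)
Definition stable_subgroup (K : Type) (V : zmodType) (D : set K)
    (act : K -> V -> V) (N I : set V) : Prop :=
  [/\ (I `<=` N)%classic, I 0,
      forall x y, I x -> I y -> I (x - y)
    & forall a x, D a -> I x -> I (act a x)].

Section StableSubgroups.
Variables (K : Type) (D : set K).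

Lemma stable_add (V : zmodType) (act : K -> V -> V) (N I : set V) x y :
  stable_subgroup D act N I -> I x -> I y -> I (x + y).
Proof.
case=> _ I0 IB _ Ix Iy; rewrite -[y]opprK; apply: (IB) => //.
by rewrite -[- y]add0r; apply: IB.
Qed.

Lemma stable_subgroup_sub (V : zmodType) (act : K -> V -> V) (N N' I : set V) :
  (N `<=` N')%classic ->
  stable_subgroup D act N I -> stable_subgroup D act N' I.
Proof. by move=> NN' [IN I0 IB IA]; split=> // x /IN/NN'. Qed.

Variables (V W : zmodType) (actV : K -> V -> V) (actW : K -> W -> W).
Variable f : {additive V -> W}.
Hypothesis fact : forall a x, D a -> f (actV a x) = actW a (f x).

(** By the modular law, two nested subgroups coincide as soon as they have the
same image under [f] and the same intersection with the kernel of [f].  So a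
chain is stationary once both induced chains are. *)
Lemma acc_extension (N : set V) :
  (forall a, D a -> actW a 0 = 0) ->
  ascending_chain_condition (stable_subgroup D actW (f @` N)%classic) ->
  ascending_chain_condition
    (stable_subgroup D actV [set x | N x /\ f x = 0]%classic) ->
  ascending_chain_condition (stable_subgroup D actV N).
Proof.
move=> actW0 accW accK I stI incI.
have stJ n : stable_subgroup D actW (f @` N)%classic (f @` I n)%classic.
  have [IN I0 IB IA] := stI n; split.
  - exact: image_subset.
  - by exists 0 => //; rewrite raddf0.
  - by move=> _ _ [x Ix <-] [y Iy <-]; exists (x - y); [apply: IB|rewrite raddfB].
  - by move=> a _ Da [x Ix <-]; exists (actV a x); [apply: IA|apply: fact].
have stK n : stable_subgroup D actV [set x | N x /\ f x = 0]%classic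
    [set x | I n x /\ f x = 0]%classic.
  have [IN I0 IB IA] := stI n; split.
  - by move=> x [/IN].
  - by split=> //; rewrite raddf0.
  - by move=> x y [Ix fx] [Iy fy]; split; [apply: IB|rewrite raddfB fx fy subr0].
  - by move=> a x Da [Ix fx]; split; [apply: IA|rewrite fact// fx actW0].
have [|N1 st1] := accW _ stJ; first by move=> n; apply/image_subset/incI.
have [|N2 st2] := accK _ stK; first by move=> n x [/incI].
exists (maxn N1 N2) => n; rewrite geq_max => /andP[N1n N2n].
set M := maxn N1 N2.
have Mn : (M <= n)%N by rewrite geq_max N1n.
apply/seteqP; split; last exact: chain_le.
move=> x Ix.
have: (f @` I n)%classic (f x) by exists x.
rewrite (chain_stable_from (M := M) st1) ?leq_maxl// => -[y Iy fyx].
have : [set x | I n x /\ f x = 0]%classic (x - y).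
  split; last by rewrite raddfB fyx subrr.
  by have [_ _ IB _] := stI n; apply: IB => //; apply: (chain_le incI Mn).
rewrite (chain_stable_from (I := fun n => [set x | I n x /\ f x = 0]%classic)
          (M := M) st2) ?leq_maxr// => -[Ixy _].
by rewrite -(subrK y x); apply: (stable_add (stI M)).
Qed.

(** Taking preimages under [f] turns a chain in the image into a chain in [N],
and no information is lost because [f] is onto [N']. *)
Lemma acc_image (N : set V) (N' : set W) :
  stable_subgroup D actV N N -> (N' `<=` f @` N)%classic ->
  ascending_chain_condition (stable_subgroup D actV N) ->
  ascending_chain_condition (stable_subgroup D actW N').
Proof.
move=> [_ N0 NB NA] N'f accN I stI incI.
pose J n := [set x | N x /\ I n (f x)]%classic.
have [n||M stJ] := accN J.
- have [_ I0 IB IA] := stI n; split=> [x []//||x y|a x].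
  + by split; rewrite ?raddf0.
  + by move=> [Nx Ix] [Ny Iy]; split; [apply: NB|rewrite raddfB; apply: IB].
  + by move=> Da [Nx Ix]; split; [apply: NA|rewrite fact//; apply: IA].
- by move=> n x [Nx /incI].
exists M => n Mn; apply/seteqP; split; last exact: chain_le.
move=> y Iy; have [/(_ y Iy)/N'f [x Nx fxy] _ _ _] := stI n.
have : J n x by split; rewrite ?fxy.
by rewrite stJ// => -[_]; rewrite fxy.
Qed.

End StableSubgroups.

Section Powers.
Variables (K : Type) (D : set K) (V : zmodType) (act : K -> V -> V) (N : set V).
Hypothesis act0 : forall a, D a -> act a 0 = 0.
Hypothesis accN : ascending_chain_condition (stable_subgroup D act N).

Let actF (T : finType) (a : K) (v : {ffun T -> V}) : {ffun T -> V} :=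
  [ffun t => act a (v t)].

(** Induction on the set of indices where functions may be nonzero: evaluation
at one more index is a homomorphism whose kernel has a smaller support. *)
Lemma acc_ffun (T : finType) :
  ascending_chain_condition
    (stable_subgroup D (@actF T) [set v | forall t, N (v t)]%classic).
Proof.
pose supp (s : seq T) := [set v : {ffun T -> V} |
  (forall t, N (v t)) /\ forall t, t \notin s -> v t = 0]%classic.
suff accs s : ascending_chain_condition (stable_subgroup D (@actF T) (supp s)).
  apply: acc_sub (accs (enum T)) => I; apply: stable_subgroup_sub => v Nv.
  by split=> // t; rewrite mem_enum.
elim: s => [|t s IHs].
  move=> I stI _; suff I0 n : I n = [set 0]%classic by exists 0%N => n; rewrite !I0.
  have [Is I0 _ _] := stI n; apply/seteqP; split=> [v /Is [_ v0]|_ ->//].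
  by apply/ffunP => t; rewrite v0// ffunE.
pose ev (v : {ffun T -> V}) := v t.
have evB : zmod_morphism ev by move=> u v; rewrite /ev !ffunE.
pose evM := GRing.isZmodMorphism.Build _ _ ev evB.
pose evA : {additive {ffun T -> V} -> V} := HB.pack ev evM.
apply: (@acc_extension K D _ _ (@actF T) act evA) => //.
- by move=> a v _; rewrite /= /ev ffunE.
- by apply: acc_sub accN => I; apply: stable_subgroup_sub => _ [v [Nv _] <-]; apply: Nv.
- apply: acc_sub IHs => I; apply: stable_subgroup_sub => v [[Nv v0] vt].
  split=> // t' t's; have [->//|t't] := eqVneq t' t.
  by apply: v0; rewrite inE negb_or t't.
Qed.

Lemma acc_matrix (m n : nat) :
  stable_subgroup D act N N ->
  ascending_chain_condition
    (stable_subgroup D (fun a (A : 'M_(m, n)) => map_mx (act a) A)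
       [set A | forall i j, N (A i j)]%classic).
Proof.
move=> [_ N0 NB NA].
pose f (v : {ffun 'I_m * 'I_n -> V}) : 'M_(m, n) := \matrix_(i, j) v (i, j).
have fB : zmod_morphism f by move=> u v; apply/matrixP => i j; rewrite !mxE !ffunE.
pose fM := GRing.isZmodMorphism.Build _ _ f fB.
pose fA : {additive {ffun 'I_m * 'I_n -> V} -> 'M_(m, n)} := HB.pack f fM.
apply: (@acc_image _ _ _ _ (@actF ('I_m * 'I_n)%type) _ fA) (@acc_ffun _).
- by move=> a v _; apply/matrixP => i j; rewrite !mxE ffunE.
- split=> //= [t|u v Nu Nv t|a v Da Nv t]; rewrite !ffunE//.
  + exact: NB.
  + exact: NA.
- move=> A NA'; exists [ffun t => A t.1 t.2] => [t|]; first by rewrite ffunE.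
  by apply/matrixP => i j; rewrite !mxE ffunE.
Qed.

End Powers.

(** * Subrings *)

Lemma subringE (R : pzRingType) (S : set R) :
  subring S <-> [/\ S 1, forall x y, S x -> S y -> S (x - y)
                  & forall x y, S x -> S y -> S (x * y)].
Proof.
split=> [[S1 SB SM]|[S1 SB SM]]; split.
- by move: S1; rewrite inE.
- by move=> x y Sx Sy; move: (SB x y); rewrite !inE; apply.
- by move=> x y Sx Sy; move: (SM x y); rewrite !inE; apply.
- by rewrite inE.
- by move=> x y; rewrite !inE; apply: SB.
- by move=> x y; rewrite !inE; apply: SM.
Qed.

Lemma subring_stable_subgroup (R : pzRingType) (S : set R) (act : R -> R -> R) :
  subring S -> (forall a x, S a -> S x -> S (act a x)) ->
  stable_subgroup S act S S.
Proof.
by move=> /subringE[S1 SB _] Sact; split=> //; rewrite -(subrr 1); apply: SB.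
Qed.

Lemma subring_generated (R : pzRingType) (A : set R) :
  subring (generated_subring A).
Proof.
apply/subringE; split=> [S [/subringE[]]//|x y Sx Sy S SA|x y Sx Sy S SA].
- by have [/subringE[_ SB _] _] := SA; apply: SB; [apply: Sx|apply: Sy].
- by have [/subringE[_ _ SM] _] := SA; apply: SM; [apply: Sx|apply: Sy].
Qed.

Section MatrixSubring.
Variables (R : pzRingType) (n : nat) (S : set R).

Definition matrices_over : set 'M[R]_n :=
  [set A | forall i j, S (A i j)]%classic.

Lemma subring_matrices_over : subring S -> subring matrices_over.
Proof.
move=> Ssub; have /subringE[S1 SB SM] := Ssub.
have S0 : S 0 by rewrite -(subrr 1); apply: SB.
have SD x y : S x -> S y -> S (x + y).
  by apply: stable_add (subring_stable_subgroup Ssub SM).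
apply/subringE; split=> [i j|A B SA SB' i j|A B SA SB' i j]; rewrite !mxE.
- by case: (i == j).
- exact: SB.
- by apply: (big_ind S) => // k _; apply: SM.
Qed.

(** A one-sided ideal of the matrix ring is stable under multiplication by the
scalar matrices with coefficient in [S], that is, under entrywise
multiplication by elements of [S].  Thus [acc_matrix] applies on each side. *)
Lemma noetherian_matrices_over :
  noetherian_subring S -> noetherian_subring matrices_over.
Proof.
move=> [Ssub accL accR]; have /subringE[S1 SB SM] := Ssub.
have S0 : S 0 by rewrite -(subrr 1); apply: SB.
have Sscal a : S a -> matrices_over a%:M.
  by move=> Sa i j; rewrite mxE; case: (i == j).
split; first exact: subring_matrices_over.
- have := @acc_matrix R S R *%R S _ accL n n (subring_stable_subgroup Ssub SM).
  move=> /(_ (fun a _ => mulr0 a)); apply: acc_sub => I [IN I0 IB IA].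
  split=> // a A Sa IA'; suff -> : map_mx ( *%R a) A = a%:M * A.
    by apply: IA => //; apply: Sscal.
  by rewrite [_ * _]mul_scalar_mx; apply/matrixP => i j; rewrite !mxE.
- have stS : stable_subgroup S (fun a x : R => x * a) S S.
    by apply: subring_stable_subgroup => // a x Sa Sx; apply: SM.
  have := acc_matrix (fun a _ => mul0r a) accR (m := n) (n := n) stS.
  apply: acc_sub => I [IN I0 IB IA].
  split=> // a A Sa IA'; suff -> : map_mx (fun x => x * a) A = A * a%:M.
    by apply: IA => //; apply: Sscal.
  apply/matrixP => i j; rewrite !mxE (bigD1 j)//= big1 ?addr0 => [|k kj].
    by rewrite mxE eqxx.
  by rewrite mxE (negbTE kj) mulr0.
Qed.

End MatrixSubring.

(** Finitely many matrices have finitely many entries, which lie in a common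
noetherian subring. *)
Lemma F_noetherian_matrix (n : nat) (R : pzRingType) :
  F_noetherian R -> F_noetherian 'M[R]_n.
Proof.
move=> FR A finA.
pose entries := (\bigcup_(ij in [set: 'I_n * 'I_n])
  (fun M : 'M[R]_n => M ij.1 ij.2) @` A)%classic.
have [|S [noethS AS]] := FR entries.
  by apply: bigcup_finite => [|ij _]; [apply: finite_finset|apply: finite_image].
exists (matrices_over S); split; first exact: noetherian_matrices_over.
by move=> M AM i j; apply: AS; exists (i, j) => //; exists M.
Qed.

(** * Finitely generated abelian groups *)

Definition subgroup (V : zmodType) : set V -> Prop :=
  stable_subgroup set0 (fun (_ : unit) (x : V) => x) setT.

(** The union of a chain of subgroups of the integers, if nonzero, is generated
by its least positive element, by Euclidean division.  The chain is stationary as soon as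
it contains this element. *)
Lemma subgroup_chain_int : ascending_chain_condition (@subgroup int).
Proof.
move=> I stI incI.
have [[d [N [d0 INd]]]|noU] := pselect (exists d N, (0 < d)%N /\ I N d%:Z).
- pose P (d : nat) := `[< (0 < d)%N /\ exists N, I N d%:Z >].
  have exP : exists d, P d by exists d; apply/asboolP; split=> //; exists N.
  case: (ex_minnP exP) => m /asboolP[m0 [M IMm]] minm.
  exists M => n Mn; apply/seteqP; split; last exact: chain_le.
  have mulI k z x : I k x -> I k (x * z).
    have [_ I0 IB _] := stI k => Ix.
    have mulN j : I k (x *+ j).
      by elim: j => [|j IHj]; rewrite ?mulr0n// mulrS; apply: stable_add (stI k) _ _.
    case: z => j; first by rewrite -mulrzz -pmulrn.
    by rewrite NegzE mulrN -[_ * _]mulrzz -pmulrn -[- _]add0r; apply: IB.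
  move=> x Ix; suff /eqP r0 : (x %% m%:Z)%Z == 0.
    by rewrite (divz_eq x m) r0 addr0 mulrC; apply: mulI.
  have rE : (x %% m%:Z)%Z = x - m%:Z * (x %/ m%:Z)%Z.
    by rewrite {2}(divz_eq x m) mulrC addrC addKr.
  have Ir : I n (x %% m%:Z)%Z.
    rewrite rE; have [_ _ IB _] := stI n; apply: IB => //.
    by apply: mulI; apply: (chain_le incI Mn).
  have r_lt : (x %% m%:Z < m%:Z)%Z by rewrite ltz_pmod.
  have : (0 <= x %% m%:Z)%Z by rewrite modz_ge0// -lt0n.
  case: (x %% m%:Z)%Z Ir r_lt => // -[//|r] Ir r_lt _.
  have : (m <= r.+1)%N by apply: minm; apply/asboolP; split=> //; exists n.
  by rewrite leqNgt -ltz_nat r_lt.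
- suff I0 n : I n = [set 0]%classic by exists 0%N => n; rewrite !I0.
  have [_ I0 IB _] := stI n; apply/seteqP; split=> [x Ix|_ ->//].
  apply: contrapT => x0; apply: noU; case: x Ix x0 => [[|j]|j] Ij j0; first by case: j0.
  + by exists j.+1, n.
  + by exists j.+1, n; split=> //; rewrite -[Posz _]opprK -NegzE -sub0r; apply: IB.
Qed.

(** A finitely generated abelian group is a quotient of a finite power of the
integers. *)
Lemma subgroup_chain_fg (V : zmodType) (k : nat) (g : 'I_k -> V) :
  (forall x, exists c : 'I_k -> int, x = \sum_(i < k) g i *~ c i) ->
  ascending_chain_condition (@subgroup V).
Proof.
move=> genV.
pose f (c : {ffun 'I_k -> int}) : V := \sum_(i < k) g i *~ c i.
have fB : zmod_morphism f.
  by move=> u v; rewrite /f -sumrB; apply: eq_bigr => i _; rewrite !ffunE mulrzBr.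
pose fM := GRing.isZmodMorphism.Build _ _ f fB.
pose fA : {additive {ffun 'I_k -> int} -> V} := HB.pack f fM.
have noact (a : unit) : set0 a -> 0 = 0 :> int by [].
have accF := acc_ffun noact subgroup_chain_int (T := 'I_k).
apply: (acc_image (f := fA) _ _ _ accF).
- by [].
- by split.
- move=> x _; have [c ->] := genV x; exists (finfun c) => //=.
  by apply: eq_bigr => i _; rewrite ffunE.
Qed.

(** Forgetting the multiplication, one-sided ideals of a subring are subgroups
of a finitely generated abelian group. *)
Lemma tightly_F_noetherian_matrix_fg (n k : nat) (R : pzRingType) (g : 'I_k -> R) :
  (forall x, exists c : 'I_k -> int, x = \sum_(i < k) g i *~ c i) ->
  tightly_F_noetherian 'M[R]_n.
Proof.
move=> genR A _.
have accM : ascending_chain_condition (@subgroup 'M[R]_n).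
  have noact (a : unit) : set0 a -> 0 = 0 :> R by [].
  have := acc_matrix noact (subgroup_chain_fg genR) (m := n) (n := n).
  have stT : stable_subgroup set0 (fun (_ : unit) (x : R) => x) setT setT by split.
  move=> /(_ stT); apply: acc_sub => I [_ I0 IB _].
  by split=> //.
split; first exact: subring_generated.
- by apply: acc_sub accM => I [_ I0 IB _]; split.
- by apply: acc_sub accM => I [_ I0 IB _]; split.
Qed.

Lemma tightly_F_noetherian_module_finite (R0 R : pzRingType) (n : nat) :
  (forall c : R0, exists z : int, c = z%:~R) ->
  module_finite_extension R0 R -> tightly_F_noetherian 'M[R]_n.
Proof.
move=> R0Z [f [_ [k [g gen]]]]; apply: (@tightly_F_noetherian_matrix_fg _ _ _ g).
move=> x; have [c ->] := gen x.
have [z zc] := choice (fun i => R0Z (c i)); exists z.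
by apply: eq_bigr => i _; rewrite zc rmorph_int mulrzl.
Qed.

(** * The Hilbert basis theorem *)

(** Let [L n d] be the left ideal of the coefficients of degree [d] of the
polynomials of degree at most [d] in the [n]-th ideal [I n].  It increases
with [n] and with [d].  Once the diagonal chain [L m m] is stationary, say from
[M] on, all [L n d] with [n] and [d] at least [M] coincide.  The finitely many
remaining degrees [d] each yield a chain, so from some [B] on the ideals
[L n d] do not depend on [n] for any [d].  Then [I n] is contained in [I B]:
an element of [I n] can be cancelled in its leading term by an element of
[I B], and one concludes by induction on the degree. *)
Theorem left_hilbert_basis (R : nzRingType) :
  ascending_chain_condition (left_ideal [set: R]) ->
  ascending_chain_condition (left_ideal [set: {poly R}]).
Proof.
move=> accR I idI incI.
pose L n d := [set c | exists p, [/\ I n p, (size p <= d.+1)%N & p`_d = c]]%classic.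
have idL n d : left_ideal setT (L n d).
  have [_ I0 IB IM] := idI n; split=> //.
  - by exists 0; rewrite size_poly0 coef0.
  - move=> _ _ [p [Ip sp <-]] [q [Iq sq <-]]; exists (p - q); split.
    + exact: IB.
    + by rewrite (leq_trans (size_polyD _ _))// size_polyN geq_max sp.
    + by rewrite coefB.
  - move=> a _ _ [p [Ip sp <-]]; exists (a%:P * p); split; first exact: IM.
    + by rewrite mul_polyC (leq_trans (size_scale_leq _ _)).
    + by rewrite coefCM.
have LSn d n : (L n d `<=` L n.+1 d)%classic.
  by move=> _ [p [/incI Ip sp <-]]; exists p.
have LSd n d : (L n d `<=` L n d.+1)%classic.
  move=> _ [p [Ip sp <-]]; exists ('X * p); split.
  - by have [_ _ _ IM] := idI n; apply: IM.
  - have [->|p0] := eqVneq p 0; first by rewrite mulr0 size_poly0.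
    by rewrite -commr_polyX size_mulX.
  - by rewrite coefXM.
have LS n m d e : (n <= m)%N -> (d <= e)%N -> (L n d `<=` L m e)%classic.
  move=> nm de c Lc; apply: (chain_le (I := L m) (LSd m) de).
  exact: (chain_le (I := fun n => L n d) (LSn d) nm).
have [|M stM] := accR (fun m => L m m) (fun m => idL m m).
  by move=> m; apply: LS.
have [N stN] := choice (fun d => accR (fun n => L n d) (idL^~ d) (LSn d)).
pose B := maxn M (\max_(d < M) N d).
have stL n d : (B <= n)%N -> (L n d `<=` L B d)%classic.
  move=> Bn c Lc; have [dM|Md] := ltnP d M.
    have NB : (N d <= B)%N.
      by rewrite leq_max (leq_bigmax (Ordinal dM) (F := fun d : 'I_M => N d)) orbT.
    by move: Lc; rewrite (stN d n) ?(leq_trans NB)// -(stN d B).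
  (* [L n d] lies in [L k k] for [k = maxn n d], which is [L M M]. *)
  apply: (LS M B M d); rewrite ?leq_maxl//.
  rewrite -(stM (maxn n d)) ?leq_max ?Md ?orbT//.
  by apply: LS Lc; rewrite ?leq_maxl ?leq_maxr.
exists B => n Bn; apply/seteqP; split; last exact: chain_le.
move=> p Ip; have [s] := ubnP (size p); elim: s p Ip => // s IHs p Ip sp.
have [_ I0 _ _] := idI B; have [_ _ IB _] := idI n.
have [->//|p0] := eqVneq p 0.
have szp : (size p).-1.+1 = size p by rewrite prednK// size_poly_gt0.
have [|q [Iq sq qp]] := stL n (size p).-1 Bn p`_(size p).-1.
  by exists p; rewrite szp.
rewrite -(subrK q p); apply: (stable_add (idI B)) => //; apply: IHs.
  by apply: IB => //; apply: (chain_le incI Bn).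
rewrite szp in sq; rewrite ltnS in sp; apply: leq_trans sp; rewrite -szp ltnS.
apply/leq_sizeP => j; rewrite leq_eqVlt => /orP[/eqP<-|pj].
  by rewrite coefB qp subrr.
rewrite szp in pj.
by rewrite coefB !nth_default ?subr0// (leq_trans sq).
Qed.

Lemma noetherian_comm (R : comPzRingType) :
  ascending_chain_condition (left_ideal [set: R]) -> noetherian R.
Proof.
move=> accL; split=> //; first by apply/subringE; split.
by apply: acc_sub accL => I [IT I0 IB IM]; split=> // a x; rewrite mulrC; apply: IM.
Qed.

Lemma noetherian_poly_int : noetherian {poly int}.
Proof.
apply: noetherian_comm; apply: left_hilbert_basis.
by apply: acc_sub subgroup_chain_int => I [_ I0 IB _]; split.
Qed.

Lemma noetherian_matrix (R : pzRingType) (n : nat) :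
  noetherian R -> noetherian 'M[R]_n.
Proof.
move=> /(noetherian_matrices_over n); congr noetherian_subring.
by apply/seteqP; split.
Qed.

(** * A triangular ring *)

(** The subring in question lies in the ring of upper triangular matrices whose
upper left entry is a constant.  There, [p E12] multiplied on the left by a
matrix of upper left entry [c] is [c p E12], so the degree of [p] does not
grow. *)
Lemma not_tightly_F_noetherian_matrix2_poly (R : nzRingType) :
  ~ tightly_F_noetherian 'M[{poly R}]_2.
Proof.
pose e12 (p : {poly R}) : 'M[{poly R}]_2 := p *: delta_mx 0 1.
pose xe22 : 'M[{poly R}]_2 := 'X *: delta_mx 1 1.
move=> /(_ ([set e12 1] `|` [set xe22])%classic) [].
  by rewrite finite_setU; split; apply: finite_set1.
set G := generated_subring _ => Gsub accL _.
have /subringE[G1 GB GM] := Gsub.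
have Gxn k : G (e12 'X^k).
  elim: k => [|k IHk]; first by move=> S [_]; apply; left.
  have -> : e12 'X^(k.+1) = e12 'X^k * xe22.
    rewrite /e12 /xe22; apply/matrixP => i j; rewrite !mxE !big_ord_recl big_ord0 !mxE.
    by case: i j => [[|[|//]] ?] [[|[|//]] ?];
      rewrite /= ?(mulr0, mul0r, mulr1, addr0, add0r, exprSr).
  by apply: GM => // S [_]; apply; right.
pose T := [set A : 'M[{poly R}]_2 | (size (A 0%R 0%R) <= 1)%N /\ A 1 0 = 0]%classic.
have GT : (G `<=` T)%classic.
  move=> A; apply; split; last first.
    by move=> _ [->|->]; split; rewrite !mxE /= ?mulr0 ?size_poly0.
  apply/subringE; split.
  - by split; rewrite !mxE //= size_poly1.
  - move=> B C [B0 B1] [C0 C1]; split; rewrite !mxE ?B1 ?C1 ?subr0//.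
    by rewrite (leq_trans (size_polyD _ _))// size_polyN geq_max B0.
  - move=> B C [B0 B1] [C0 C1].
    have l1 : lift 0 0 = 1 :> 'I_2 by apply/val_inj.
    split; rewrite !mxE !big_ord_recl big_ord0 !l1 ?B1 ?C1 ?(mulr0, mul0r, addr0)//.
    by rewrite (size1_polyC B0) (size1_polyC C0) -polyCM size_polyC leq_b1.
(* The ideal [I N.+1] contains ['X^N E12], which is not in [I N]. *)
pose I k := [set A | G A /\ exists2 p : {poly R}, (size p <= k)%N & A = e12 p]%classic.
have [k|k A [GA [p sp Ap]]|N /(_ N.+1 (leqnSn N)) eqI] := accL I.
- split=> [A []//||A B [GA [p sp Ap]] [GB' [q sq Bq]]|B A GB' [GA [p sp Ap]]].
  + split; first by rewrite -(subrr 1); apply: GB.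
    by exists 0; rewrite ?size_poly0// /e12 scale0r.
  + split; first exact: GB.
    exists (p - q); last by rewrite Ap Bq /e12 scalerBl.
    by rewrite (leq_trans (size_polyD _ _))// size_polyN geq_max sp.
  + split; first exact: GM.
    have [B0 B1] := GT _ GB'.
    exists (B 0 0 * p).
      by rewrite (size1_polyC B0) mul_polyC (leq_trans (size_scale_leq _ _)).
    rewrite Ap; apply/matrixP => i j.
    rewrite !mxE !big_ord_recl big_ord0 !mxE /= !mulr0 !addr0 mulrA.
    have [->//|i0] := eqVneq i 0.
    have -> : i = 1 by case: i i0 => [[|[|//]] ?] // _; apply/val_inj.
    by rewrite B1 !mul0r mulr0.
- by split=> //; exists p => //; apply: leqW.
- have: I N.+1 (e12 'X^N) by split=> //; exists 'X^N; rewrite ?size_polyXn.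
  rewrite eqI => -[_ [p sp /matrixP/(_ 0 1)]].
  by rewrite !mxE /= !mulr1 => pX; move: sp; rewrite -pX size_polyXn ltnn.
Qed.

Theorem proposition8p1 :
  ((forall n : nat, tightly_F_noetherian 'M[int]_n) /\
   (forall (n : nat) (R : pzRingType),
      module_finite_extension int R \/
      (exists p : nat, prime p /\ module_finite_extension 'F_p R) ->
      tightly_F_noetherian 'M[R]_n)) /\
  (noetherian 'M[{poly int}]_2 /\ ~ tightly_F_noetherian 'M[{poly int}]_2) /\
  (forall (n : nat) (R : pzRingType),
     F_noetherian R -> F_noetherian 'M[R]_n).
Proof.
have intZ (c : int) : exists z : int, c = z%:~R by exists c; rewrite intz.
split; [split|split; [split|]].
- move=> n; apply: (@tightly_F_noetherian_matrix_fg n 1 int (fun=> 1)) => x.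
  by exists (fun=> x); rewrite big_ord1 intz.
- move=> n R [|[p [_]]]; apply: tightly_F_noetherian_module_finite => // c.
  by exists (c : nat)%:Z; rewrite -pmulrn natr_Zp.
- exact: noetherian_matrix noetherian_poly_int.
- exact: not_tightly_F_noetherian_matrix2_poly.
- exact: F_noetherian_matrix.
Qed.
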